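(* Let $\sigma$ be an irreducible Pisot substitution on $\mathcal A=\{1,\dots,n\}$. With the spaces $Z$, $Z_{\rm ext}$, $V\cdot\mathbb Z[\alpha^{-1}]$, $K_\alpha$ and the maps $\Psi,\Phi,f,F$ of the context, consider the cube whose top face has the corners $Z,Z,Z_{\rm ext},Z_{\rm ext}$ and whose bottom face has the corners $V\cdot\mathbb Z[\alpha^{-1}],V\cdot\mathbb Z[\alpha^{-1}],K_\alpha,K_\alpha$, with edges $M_\sigma:Z\to Z$, $M_\sigma:Z_{\rm ext}\to Z_{\rm ext}$, multiplication by $\alpha$ on $V\cdot\mathbb Z[\alpha^{-1}]$ and on $K_\alpha$, $\Psi:Z\to Z_{\rm ext}$ (twice), $\Phi:V\cdot\mathbb Z[\alpha^{-1}]\to K_\alpha$ (twice), $f^{-1}:Z\to V\cdot\mathbb Z[\alpha^{-1}]$ (twice), $F:Z_{\rm ext}\to K_\alpha$ (twice). Then each square of this cube is commutative, that is, $$\Psi\circ M_\sigma=M_\sigma\circ\Psi,\qquad f^{-1}\circ M_\sigma=\alpha\cdot f^{-1},\qquad F\circ M_\sigma=\alpha\cdot F,\qquad \Phi(\alpha x)=\alpha\cdot\Phi(x)\ \ (x\in V\cdot\mathbb Z[\alpha^{-1}]),\qquad F\circ\Psi=\Phi\circ f^{-1}.$$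
   Context: A substitution on $\mathcal A=\{1,\dots,n\}$ is an endomorphism $\sigma$ of the free monoid $\mathcal A^*$ such that the image of each letter is non-empty and $|\sigma^k(a)|\to\infty$ for at least one letter $a$. Its incidence matrix $M_\sigma$ has entries $(M_\sigma)_{a,b}=|\sigma(b)|_a$ (number of occurrences of $a$ in $\sigma(b)$). $\sigma$ is an irreducible Pisot substitution if $M_\sigma$ is primitive with characteristic polynomial irreducible over $\mathbb Q$ and its dominant eigenvalue $\alpha$ is a Pisot number (algebraic integer $>1$ all of whose other conjugates have modulus $<1$); $\alpha$ need not be a unit. $K=\mathbb Q(\alpha)$, $S_\alpha$ is the set of primes (places) $\mathfrak p$ of $K$ that are infinite or are finite and divide $(\alpha)$, $K_{\mathfrak p}$ is the completion of $K$ at $\mathfrak p$, $K_\infty=\prod_{\mathfrak p\mid\infty}K_{\mathfrak p}$, $K_\alpha=\prod_{\mathfrak p\in S_\alpha}K_{\mathfrak p}$. $\Phi:K\to K_\alpha$ and $\Phi_\infty:K\to K_\infty$ are the diagonal embeddings. $K$ acts on $K_\alpha$ by coordinatewise multiplication. $\mathbf v_\alpha=(v_1,\dots,v_n)$ is a left eigenvector of $M_\sigma$ for $\alpha$ with entries in $\mathbb Q(\alpha)$; $V=\langle v_1,\dots,v_n\rangle_{\mathbb Z}$, and $V\cdot\mathbb Z[\alpha^{-1}]$ is the additive subgroup of $K$ generated by the products $vy$, $v\in V$, $y\in\mathbb Z[\alpha^{-1}]$. $Z=\bigcup_{k\ge0}M_\sigma^{-k}\mathbb Z^n\subset\mathbb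 Q^n$. $f:\mathbb Q(\alpha)\to\mathbb Q^n$ sends $z_1v_1+\dots+z_nv_n$ ($z_i\in\mathbb Q$) to $(z_1,\dots,z_n)^t$, so $f^{-1}(\mathbf x)=\langle\mathbf x,\mathbf v_\alpha\rangle$; it restricts to a bijection between $V\cdot\mathbb Z[\alpha^{-1}]$ and $Z$. $Z_{\rm ext}=Z\times\prod_{\mathfrak p\mid(\alpha)}K_{\mathfrak p}$; $\Psi:Z\to Z_{\rm ext}$, $\Psi(\mathbf x)=(\mathbf x,\langle\mathbf x,\mathbf v_\alpha\rangle,\dots,\langle\mathbf x,\mathbf v_\alpha\rangle)$. $M_\sigma$ is extended to $Z_{\rm ext}$ by acting as $M_\sigma$ on $Z$ and as multiplication by $\alpha$ on each factor $K_{\mathfrak p}$, $\mathfrak p\mid(\alpha)$. $F:Z_{\rm ext}\to K_\alpha$ is given by the block matrix $F=\begin{pmatrix}\Phi_\infty(v_1)^t\cdots\Phi_\infty(v_n)^t&\mathbf 0\\ \mathbf 0&I\end{pmatrix}$, i.e. $F(\mathbf x,\mathbf y)=\big(\sum_{i}x_i\Phi_\infty(v_i),\mathbf y\big)$ for $\mathbf x=(x_1,\dots,x_n)^t\in Z$, $\mathbf y\in\prod_{\mathfrak p\mid(\alpha)}K_{\mathfrak p}$. *)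

(* Defs.v *)
From HB Require Import structures.
From mathcomp Require Import all_boot all_order all_algebra all_field.
From mathcomp Require Import all_classical all_reals.
From mathcomp Require Import exp ring lra.

Set Implicit Arguments.
Unset Strict Implicit.
Unset Printing Implicit Defensive.

Import Order.TTheory GRing.Theory Num.Theory.
Local Open Scope classical_set_scope.
Local Open Scope quotient_scope.
Local Open Scope ring_scope.

Record substitution (n : nat) := Substitution {
  subst :> seq 'I_n -> seq 'I_n;
  subst_nil : subst [::] = [::];
  subst_cat : {morph subst : u w / u ++ w};
  subst_nonempty : forall a : 'I_n, subst [:: a] != [::];
  subst_growth : exists a : 'I_n, forall N : nat, exists k0 : nat,
    forall k : nat, (k0 <= k)%N -> (N <= size (iter k subst [:: a]))%N }.

Definition incidence_mx (n : nat) (s : substitution n) : 'M[rat]_n :=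
  \matrix_(a, b) (count_mem a (s [:: b]))%:R.

Definition primitive_mx (n : nat) (M : 'M[rat]_n) : Prop :=
  exists2 k : nat, (0 < k)%N & forall i j, 0 < (M ^+ k) i j.

(** Strict dominance over the other eigenvalues; for a primitive matrix this
    singles out the Perron-Frobenius eigenvalue. *)
Definition dominant_eigenvalue (n : nat) (M : 'M[rat]_n) (a : algC) : Prop :=
  eigenvalue (map_mx ratr M) a /\
  forall b : algC, eigenvalue (map_mx ratr M) b -> b != a -> `|b| < `|a|.

Definition Pisot_number (a : algC) : Prop :=
  [/\ a \in Aint, 1 < a
    & forall b : algC, root (minCpoly a) b -> b != a -> `|b| < 1].

Definition irreducible_Pisot (n : nat) (s : substitution n) : Prop :=
  [/\ primitive_mx (incidence_mx s),
      irreducible_poly (char_poly (incidence_mx s))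
    & exists2 a : algC, dominant_eigenvalue (incidence_mx s) a
                      & Pisot_number a].

Section AbsVal.
Context (R : realType) (K : fieldType).

Record absval := AbsVal {
  av :> K -> R;
  av_ge0 : forall x, 0 <= av x;
  av_eq0 : forall x, av x = 0 <-> x = 0;
  avM : {morph av : x y / x * y};
  avD : forall x y, av (x + y) <= av x + av y;
  av_nontrivial : exists2 x, x != 0 & av x != 1 }.

HB.instance Definition _ := gen_eqMixin absval.
HB.instance Definition _ := gen_choiceMixin absval.

Definition av_equiv (v w : absval) : bool :=
  `[< exists2 s : R, 0 < s & forall x, w x = v x `^ s >].

Lemma av_equiv_refl : reflexive av_equiv.
Proof.
by move=> v; apply/asboolP; exists 1 => // x; rewrite powRr1 // av_ge0.
Qed.

Lemma av_equiv_sym : symmetric av_equiv.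
Proof.
suff S v w : av_equiv v w -> av_equiv w v.
  by move=> v w; apply/idP/idP; apply: S.
move=> /asboolP [s s0 vw]; apply/asboolP; exists s^-1; first by rewrite invr_gt0.
by move=> x; rewrite vw -powRrM mulfV ?gt_eqF // powRr1 // av_ge0.
Qed.

Lemma av_equiv_trans : transitive av_equiv.
Proof.
move=> w v u /asboolP [s s0 vw] /asboolP [t t0 wu]; apply/asboolP.
by exists (s * t); [rewrite mulr_gt0 | move=> x; rewrite wu vw powRrM].
Qed.

Canonical av_equiv_rel :=
  EquivRel av_equiv av_equiv_refl av_equiv_sym av_equiv_trans.

(** A place is an equivalence class of nontrivial absolute values; it is finite
    when it is nonarchimedean and infinite otherwise. *)
Definition place := {eq_quot av_equiv_rel}.

Definition nonarchimedean (v : absval) : Prop :=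
  forall x y, v (x + y) <= Num.max (v x) (v y).

Definition finite_place (p : place) : Prop := nonarchimedean (repr p).
Definition infinite_place (p : place) : Prop := ~ finite_place p.

Section Completion.
Variable v : absval.

Definition cauchy_seq (u : nat -> K) : Prop :=
  forall e : R, 0 < e -> exists N : nat, forall i j : nat,
    (N <= i)%N -> (N <= j)%N -> v (u i - u j) < e.

Definition null_seq (u : nat -> K) : Prop :=
  forall e : R, 0 < e -> exists N : nat, forall i : nat,
    (N <= i)%N -> v (u i) < e.

Lemma av0 : v 0 = 0. Proof. exact/av_eq0. Qed.
Lemma av1 : v 1 = 1.
Proof.
have n0 : v 1 != 0 by apply/eqP => /av_eq0 /eqP; rewrite oner_eq0.
by apply: (mulfI n0); rewrite -avM !mulr1.
Qed.
Lemma avN x : v (- x) = v x.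
Proof.
have /eqP : v (-1) ^+ 2 = 1 by rewrite expr2 -avM mulrNN mulr1 av1.
rewrite sqrf_eq1 => /orP [/eqP h|/eqP h]; first by rewrite -mulN1r avM h mul1r.
by have := av_ge0 v (-1); rewrite h oppr_ge0 leNgt ltr01.
Qed.
Lemma avB x y : v (x - y) <= v x + v y.
Proof. by rewrite -(avN y) avD. Qed.
Lemma avV x : v x^-1 = (v x)^-1.
Proof.
have [->|x0] := eqVneq x 0; first by rewrite invr0 av0 invr0.
have n0 : v x != 0 by apply/eqP => /av_eq0 /eqP; rewrite (negPf x0).
by apply: (mulfI n0); rewrite -avM !mulfV // av1.
Qed.

Lemma cauchy_bounded u : cauchy_seq u -> exists2 B : R, 0 < B & forall i, v (u i) <= B.
Proof.
move=> /(_ 1 ltr01) [N hN].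
pose S := \sum_(j < N.+1) v (u j).
have S0 : 0 <= S by apply: sumr_ge0 => j _; exact: av_ge0.
have hS j : (j < N.+1)%N -> v (u j) <= S.
  move=> jN; rewrite /S (bigD1 (Ordinal jN)) //= lerDl.
  by apply: sumr_ge0 => k _; exact: av_ge0.
exists (S + 1); first by rewrite ltr_wpDl.
move=> i; have [iN|Ni] := ltnP i N.+1.
  by apply: (le_trans (hS _ iN)); rewrite lerDl ler01.
rewrite -[u i](subrK (u N)) addrC; apply: (le_trans (avD _ _ _)).
apply: lerD; first exact: hS.
by apply/ltW/hN => //; exact: ltnW.
Qed.

Lemma null_cauchy u : null_seq u -> cauchy_seq u.
Proof.
move=> hu e e0; have e2 : 0 < e / 2 by rewrite divr_gt0.
have [N hN] := hu _ e2; exists N => i j iN jN.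
by apply: (le_lt_trans (avB _ _)); rewrite [e]splitr ltrD // hN.
Qed.

Definition cauchy_pred : {pred (nat -> K)} := fun u => `[< cauchy_seq u >].

Lemma cauchy_subring : subring_closed cauchy_pred.
Proof.
split.
- by apply/asboolP => e e0; exists 0%N => i j _ _; rewrite /= subrr av0.
- move=> u w /asboolP hu /asboolP hw; apply/asboolP => e e0.
  have e2 : 0 < e / 2 by rewrite divr_gt0.
  have [N hN] := hu _ e2; have [N' hN'] := hw _ e2.
  exists (maxn N N') => i j; rewrite !geq_max => /andP [i1 i2] /andP [j1 j2].
  have -> : (u - w) i - (u - w) j = (u i - u j) - (w i - w j).
    have E k : (u - w) k = u k - w k by [].
    by rewrite !E; ring.
  by apply: (le_lt_trans (avB _ _)); rewrite [e]splitr ltrD ?hN ?hN'.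
- move=> u w /asboolP hu /asboolP hw; apply/asboolP => e e0.
  have [B B0 hB] := cauchy_bounded hu; have [C C0 hC] := cauchy_bounded hw.
  have eC : 0 < e / 2 / C by rewrite !divr_gt0.
  have eB : 0 < e / 2 / B by rewrite !divr_gt0.
  have [N hN] := hu _ eC; have [N' hN'] := hw _ eB.
  exists (maxn N N') => i j; rewrite !geq_max => /andP [i1 i2] /andP [j1 j2].
  have -> : (u * w) i - (u * w) j = (u i - u j) * w i + u j * (w i - w j).
    have E k : (u * w) k = u k * w k by [].
    by rewrite !E; ring.
  apply: (le_lt_trans (avD _ _ _)); rewrite !avM [e]splitr; apply: ltrD.
    apply: (@le_lt_trans _ _ (v (u i - u j) * C)).
      by rewrite ler_wpM2l ?av_ge0.
    by rewrite -ltr_pdivlMr // hN.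
  apply: (@le_lt_trans _ _ (B * v (w i - w j))).
    by rewrite ler_wpM2r ?av_ge0.
  by rewrite mulrC -ltr_pdivlMr // hN'.
Qed.

HB.instance Definition _ :=
  GRing.isSubringClosed.Build (nat -> K) cauchy_pred cauchy_subring.

Record cauchy_ring := CauchySeq {
  cseq : nat -> K; cseqP : cseq \in cauchy_pred }.

HB.instance Definition _ := [isSub for cseq].
HB.instance Definition _ := [Choice of cauchy_ring by <:].
HB.instance Definition _ := [SubChoice_isSubComNzRing of cauchy_ring by <:].

Definition null_pred : {pred cauchy_ring} := fun u => `[< null_seq (cseq u) >].

Lemma null_ideal : idealr_closed null_pred.
Proof.
split.
- by apply/asboolP => e e0; exists 0%N => i _; rewrite [cseq 0 i]/(0 : K) av0.
- apply/asboolP => /(_ 1 ltr01) [N /(_ N (leqnn N))].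
  by rewrite [cseq 1 N]/(1 : K) av1 ltxx.
- move=> a u w /asboolP hu /asboolP hw; apply/asboolP => e e0.
  have [B B0 hB] := cauchy_bounded (asboolW (cseqP a)).
  have e2 : 0 < e / 2 by rewrite divr_gt0.
  have eB : 0 < e / 2 / B by rewrite !divr_gt0.
  have [N hN] := hu _ eB; have [N' hN'] := hw _ e2.
  exists (maxn N N') => i; rewrite !geq_max => /andP [i1 i2].
  rewrite [cseq _ i]/(cseq a i * cseq u i + cseq w i).
  apply: (le_lt_trans (avD _ _ _)); rewrite !avM [e]splitr.
  rewrite ltrD ?hN' //; apply: (@le_lt_trans _ _ (B * v (cseq u i))).
    by rewrite ler_wpM2r ?av_ge0.
  by rewrite mulrC -ltr_pdivlMr // hN.
Qed.

HB.instance Definition _ := isIdealr.Build cauchy_ring null_pred null_ideal.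

Definition completion := {ideal_quot null_pred}.
HB.instance Definition _ := GRing.ComNzRing.on completion.

Lemma pi_eq0 u : (\pi_completion u == 0 :> completion) = (u \in null_pred).
Proof.
by rewrite -(rmorph0 \pi_completion) -[u in RHS]subr0 Quotient.idealrBE.
Qed.

Lemma completion_unit (x : completion) : x != 0 -> exists y, y * x = 1.
Proof.
rewrite -[x]reprK; move: (repr x) => u.
rewrite pi_eq0 => /asboolPn nu.
have [e e0 he] : exists2 e : R, 0 < e &
    forall N, exists2 i, (N <= i)%N & e <= v (cseq u i).
  apply: contrapT => H; apply: nu => e e0; apply: contrapT => H'; apply: H.
  exists e => // N; apply: contrapT => H''; apply: H'; exists N => i Ni.
  by rewrite ltNge; apply/negP => ei; apply: H''; exists i.
have e2 : 0 < e / 2 by rewrite divr_gt0.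
have [N hN] := asboolW (cseqP u) _ e2.
have hv i : (N <= i)%N -> e / 2 <= v (cseq u i).
  move=> Ni; have [j Nj ej] := he N.
  have := avD v (cseq u j - cseq u i) (cseq u i); rewrite subrK => h.
  have h' := hN _ _ Nj Ni; lra.
have un0 i : (N <= i)%N -> cseq u i != 0.
  move=> Ni; apply/eqP => u0; have := hv i Ni.
  by rewrite u0 av0 leNgt e2.
pose w i := (cseq u i)^-1.
have cw : w \in cauchy_pred.
  apply/asboolP => d d0.
  have dd : 0 < d * (e / 2 * (e / 2)) := mulr_gt0 d0 (mulr_gt0 e2 e2).
  have [N' hN'] := asboolW (cseqP u) _ dd.
  exists (maxn N N') => i j; rewrite !geq_max => /andP [i1 i2] /andP [j1 j2].
  have -> : w i - w j = (cseq u j - cseq u i) * (cseq u i * cseq u j)^-1.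
    by rewrite /w; field; rewrite !un0.
  rewrite avM avV avM ltr_pdivrMr; last first.
    by rewrite mulr_gt0 // (lt_le_trans e2) // hv.
  apply: (lt_le_trans (hN' _ _ j2 i2)); rewrite ler_wpM2l ?(ltW d0) //.
  by rewrite ler_pM ?(ltW e2) // hv.
exists (\pi_completion (CauchySeq cw)).
rewrite -rmorphM -(rmorph1 \pi_completion); apply/eqP.
rewrite -Quotient.idealrBE; apply/asboolP => d d0; exists N => i Ni.
have E : (cseq u i)^-1 * cseq u i - 1 = 0 by rewrite mulVf ?un0 ?subrr.
by rewrite [cseq _ i]E av0.
Qed.

Definition completion_inv (x : completion) : completion :=
  if x == 0 then 0 else xget 0 [set y | y * x = 1].

Lemma completion_mulVf x : x != 0 -> completion_inv x * x = 1.
Proof.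
move=> x0; rewrite /completion_inv (negPf x0).
by have [y hy] := completion_unit x0; case: xgetP => [z _ //|/(_ y)].
Qed.

Lemma completion_invr0 : completion_inv 0 = 0.
Proof. by rewrite /completion_inv eqxx. Qed.

HB.instance Definition _ := GRing.ComNzRing_isField.Build completion
  completion_mulVf completion_invr0.

Lemma cst_cauchy (x : K) : (fun=> x) \in cauchy_pred.
Proof. by apply/asboolP => e e0; exists 0%N => i j _ _; rewrite subrr av0. Qed.

Definition to_completion (x : K) : completion :=
  \pi_completion (CauchySeq (cst_cauchy x)).

Lemma to_completion_zmod_morphism : zmod_morphism to_completion.
Proof.
move=> x y; rewrite /to_completion -rmorphB.
by congr (\pi_completion _); exact: val_inj.
Qed.

Lemma to_completion_monoid_morphism : monoid_morphism to_completion.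
Proof.
split=> [|x y]; rewrite /to_completion.
  by rewrite -(rmorph1 \pi_completion); congr (\pi_completion _); exact: val_inj.
by rewrite -rmorphM; congr (\pi_completion _); exact: val_inj.
Qed.

HB.instance Definition _ := GRing.isZmodMorphism.Build K completion
  to_completion to_completion_zmod_morphism.
HB.instance Definition _ := GRing.isMonoidMorphism.Build K completion
  to_completion to_completion_monoid_morphism.

End Completion.
End AbsVal.

Section Qadj.
Variable a : algC.

(** A zero denominator gives the quotient 0. *)
Definition Qadj_pred : {pred algC} := fun x => `[< exists p q : {poly rat},
  x = (map_poly ratr p).[a] / (map_poly ratr q).[a] >].

Lemma Qadj_divring : divring_closed Qadj_pred.
Proof.
split.
- by apply/asboolP; exists 1, 1; rewrite !rmorph1 hornerE divff ?oner_eq0.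
- move=> x y /asboolP [p [q ->]] /asboolP [r [t ->]]; apply/asboolP.
  have [q0|q0] := eqVneq (map_poly (ratr : rat -> algC) q).[a] 0.
    by exists (- r), t; rewrite q0 invr0 mulr0 sub0r rmorphN hornerN mulNr.
  have [t0|t0] := eqVneq (map_poly (ratr : rat -> algC) t).[a] 0.
    by exists p, q; rewrite t0 invr0 mulr0 subr0.
  exists (p * t - r * q), (q * t).
  rewrite !(rmorphB, rmorphM) /= !hornerE; field.
  by apply/andP.
- move=> x y /asboolP [p [q ->]] /asboolP [r [t ->]]; apply/asboolP.
  exists (p * t), (q * r); rewrite !rmorphM /= !hornerE !invfM invrK.
  by rewrite -!mulrA; congr (_ * _); rewrite [RHS]mulrC -mulrA.
Qed.

HB.instance Definition _ :=
  GRing.isDivringClosed.Build algC Qadj_pred Qadj_divring.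

Record Qadj := MkQadj { Qadj_val : algC; Qadj_valP : Qadj_val \in Qadj_pred }.

HB.instance Definition _ := [isSub for Qadj_val].
HB.instance Definition _ := [Choice of Qadj by <:].
HB.instance Definition _ := [SubChoice_isSubIntegralDomain of Qadj by <:].
HB.instance Definition _ := [SubIntegralDomain_isSubField of Qadj by <:].

Lemma Qadj_gen_in : a \in Qadj_pred.
Proof. by apply/asboolP; exists 'X, 1; rewrite map_polyX rmorph1 !hornerE divr1. Qed.

Definition Qadj_gen : Qadj := MkQadj Qadj_gen_in.

Lemma Qadj_rat_in (x : rat) : ratr x \in Qadj_pred.
Proof.
by apply/asboolP; exists x%:P, 1; rewrite map_polyC rmorph1 !hornerE invr1 mulr1.
Qed.

(** Not ratr, which is a morphism only into a numFieldType. *)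
Definition Qadj_rat (x : rat) : Qadj := MkQadj (Qadj_rat_in x).

Lemma Qadj_rat_zmod_morphism : zmod_morphism Qadj_rat.
Proof. by move=> x y; apply: val_inj; rewrite /= rmorphB. Qed.

Lemma Qadj_rat_monoid_morphism : monoid_morphism Qadj_rat.
Proof. by split=> [|x y]; apply: val_inj; rewrite /= ?rmorph1 ?rmorphM. Qed.

HB.instance Definition _ :=
  GRing.isZmodMorphism.Build rat Qadj Qadj_rat Qadj_rat_zmod_morphism.
HB.instance Definition _ :=
  GRing.isMonoidMorphism.Build rat Qadj Qadj_rat Qadj_rat_monoid_morphism.

End Qadj.

Section Products.
Context (R : realType) (a : algC).
Local Notation K := (Qadj a).

(** The completion at p is taken for a chosen absolute value in the class p; the
    others in the class have the same Cauchy and null sequences. *)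
Definition prod_completions (S : set (place R K)) : Type :=
  forall p : S, completion (repr (val p)).

Section Structure.
Variable S : set (place R K).
Local Notation KS := (prod_completions S).
Implicit Types x y z : KS.

HB.instance Definition _ := gen_eqMixin KS.
HB.instance Definition _ := gen_choiceMixin KS.

Let addKA : associative (fun x y : KS => (fun p => x p + y p) : KS).
Proof. by move=> x y z; apply: functional_extensionality_dep => p; rewrite addrA. Qed.
Let addKC : commutative (fun x y : KS => (fun p => x p + y p) : KS).
Proof. by move=> x y; apply: functional_extensionality_dep => p; rewrite addrC. Qed.
Let add0K : left_id ((fun=> 0) : KS) (fun x y : KS => (fun p => x p + y p) : KS).
Proof. by move=> x; apply: functional_extensionality_dep => p; rewrite add0r. Qed.
Let addNK : left_inverse ((fun=> 0) : KS) (fun x : KS => (fun p => - x p) : KS)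
  (fun x y : KS => (fun p => x p + y p) : KS).
Proof. by move=> x; apply: functional_extensionality_dep => p; rewrite addNr. Qed.

HB.instance Definition _ := GRing.isZmodule.Build KS addKA addKC add0K addNK.

Definition scaleK (c : K) (y : KS) : KS :=
  fun p => to_completion (repr (val p)) c * y p.

Let scaleKA b c y : scaleK b (scaleK c y) = scaleK (b * c) y.
Proof.
by apply: functional_extensionality_dep => p; rewrite /scaleK rmorphM mulrA.
Qed.
Let scale1K : left_id 1 scaleK.
Proof.
by move=> y; apply: functional_extensionality_dep => p; rewrite /scaleK rmorph1 mul1r.
Qed.
Let scaleKDr : right_distributive scaleK +%R.
Proof.
by move=> c x y; apply: functional_extensionality_dep => p; rewrite /scaleK mulrDr.
Qed.
Let scaleKDl y : {morph scaleK^~ y : b c / b + c}.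
Proof.
by move=> b c; apply: functional_extensionality_dep => p; rewrite /scaleK rmorphD mulrDl.
Qed.

HB.instance Definition _ :=
  GRing.Zmodule_isLmodule.Build K KS scaleKA scale1K scaleKDr scaleKDl.

Definition diag (c : K) : KS := fun p => to_completion (repr (val p)) c.

End Structure.

Definition ring_of_integers : set K := [set x | val x \in Aint].

Definition principal_ideal (c : K) : set K := [set c * x | x in ring_of_integers].

Definition prime_ideal (p : place R K) : set K :=
  [set x | ring_of_integers x /\ repr p x < 1].

Definition infinite_places : set (place R K) := [set p | infinite_place p].

Definition finite_places_dividing (c : K) : set (place R K) :=
  [set p | finite_place p /\ principal_ideal c `<=` prime_ideal p].

Definition S_alpha : set (place R K) :=
  infinite_places `|` finite_places_dividing (Qadj_gen a).

Definition K_infty : Type := prod_completions infinite_places.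
Definition K_fin : Type := prod_completions (finite_places_dividing (Qadj_gen a)).
Definition K_alpha : Type := prod_completions S_alpha.

Lemma S_alpha_finite (p : S_alpha) :
  ~ infinite_place (val p) -> val p \in finite_places_dividing (Qadj_gen a).
Proof. by move=> np; have := set_mem (valP p) => -[//|?]; exact: mem_set. Qed.

(** The identification of K_infty * K_fin with K_alpha. *)
Definition join_completions (x : K_infty) (y : K_fin) : K_alpha := fun p =>
  match pselect (infinite_place (val p)) with
  | left h => x (exist _ (val p) (mem_set h))
  | right h => y (exist _ (val p) (S_alpha_finite h))
  end.

End Products.

Arguments diag {R a} S c.

Definition zspan (U : zmodType) (S : set U) : set U := [set w |
  exists (m : nat) (c : 'I_m -> int) (s : 'I_m -> U),
    (forall i, S (s i)) /\ w = \sum_i s i *~ c i].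

Section Zspan.
Variable U : zmodType.
Implicit Types S : set U.

Lemma zspan_gen S w : S w -> zspan S w.
Proof.
move=> Sw; exists 1%N, (fun=> 1), (fun=> w); split=> //.
by rewrite big_ord1 mulr1z.
Qed.

Lemma zspan0 S : zspan S 0.
Proof.
exists 0%N, (fun=> 0), (fun=> 0); split; first by case.
by rewrite big_ord0.
Qed.

Lemma zspanD S x y : zspan S x -> zspan S y -> zspan S (x + y).
Proof.
move=> [m [c [s [hs ->]]]] [m' [c' [s' [hs' ->]]]].
exists (m + m')%N, (fun i : 'I_(m + m') => match fintype.split i with inl j => c j | inr j => c' j end),
  (fun i : 'I_(m + m') => match fintype.split i with inl j => s j | inr j => s' j end); split.
  by move=> i; case: fintype.split.
rewrite big_split_ord; congr (_ + _); apply: eq_bigr => i _.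
  by rewrite -[lshift _ _]/(unsplit (inl i)) unsplitK.
by rewrite -[rshift _ _]/(unsplit (inr i)) unsplitK.
Qed.

Lemma zspanMz S x (k : int) : zspan S x -> zspan S (x *~ k).
Proof.
move=> [m [c [s [hs ->]]]]; exists m, (fun i => c i * k), s; split=> //.
by rewrite mulrz_suml; apply: eq_bigr => i _; rewrite mulrzA.
Qed.

Lemma zspan_sum S (I : finType) (F : I -> U) :
  (forall i, zspan S (F i)) -> zspan S (\sum_i F i).
Proof.
move=> h; elim/big_rec: _ => [|i x _]; first exact: zspan0.
exact: zspanD.
Qed.

End Zspan.

Lemma zspan_morph (U W : zmodType) (g : {additive U -> W}) (S : set U) (T : set W) :
  (forall x, S x -> zspan T (g x)) -> forall x, zspan S x -> zspan T (g x).
Proof.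
move=> h _ [m [c [s [hs ->]]]]; rewrite raddf_sum; apply: zspan_sum => i.
by rewrite raddfMz; apply/zspanMz/h.
Qed.

Section Lattices.
Context (n : nat) (sigma : substitution n) (a : algC) (v : 'rV[Qadj a]_n).
Local Notation K := (Qadj a).
Local Notation alpha := (Qadj_gen a).
Local Notation M := (incidence_mx sigma).

Definition left_eigenvector : Prop :=
  v != 0 /\ v *m map_mx (@Qadj_rat a) M = alpha *: v.

Definition Zn : set 'cV[rat]_n := [set map_mx intr z | z in [set: 'cV[int]_n]].

Definition Z_set : set 'cV[rat]_n :=
  \bigcup_k [set invmx M ^+ k *m z | z in Zn].

Definition V_set : set K := zspan (range (v 0)).

Definition Zalphainv : set K :=
  [set (map_poly intr p).[alpha^-1] | p in [set: {poly int}]].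

Definition VZ_set : set K := zspan [set w * y | w in V_set & y in Zalphainv].

(** <x, v> *)
Definition pairing (x : 'cV[rat]_n) : K := \sum_i Qadj_rat a (x i 0) * v 0 i.

Lemma pairingE x : pairing x = (v *m map_mx (@Qadj_rat a) x) 0 0.
Proof. by rewrite mxE; apply: eq_bigr => i _; rewrite mxE mulrC. Qed.

Lemma Zn_mulmx z : Zn z -> Zn (M *m z).
Proof.
move=> [w _ <-]; exists ((\matrix_(i, j) (count_mem i (sigma [:: j]))%:Z) *m w) => //.
rewrite map_mxM; congr (_ *m _); apply/matrixP => i j.
by rewrite !mxE.
Qed.

Lemma Z_set_mulmx x : Z_set x -> Z_set (M *m x).
Proof.
move=> [k _ [z Zz <-]]; exists k => //.
have cM : M *m invmx M ^+ k = invmx M ^+ k *m M.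
  have c1 : GRing.comm M (invmx M).
    rewrite /GRing.comm; have [uM|nuM] := boolP (M \in unitmx).
      by rewrite [LHS]mulmxV // [RHS]mulVmx.
    by rewrite /invmx (negPf nuM).
  exact: commrX.
by rewrite mulmxA cM -mulmxA; exists (M *m z) => //; exact: Zn_mulmx.
Qed.

Lemma pairing_Zn z : Zn z -> V_set (pairing z).
Proof.
move=> [w _ <-]; apply: zspan_sum => i; rewrite mxE rmorph_int mulrzl.
by apply/zspanMz/zspan_gen; exists i.
Qed.

Hypothesis hv : left_eigenvector.

Lemma pairing_mulmx x : pairing (M *m x) = alpha * pairing x.
Proof. by rewrite !pairingE map_mxM mulmxA hv.2 -scalemxAl mxE. Qed.

Lemma V_set_alpha w : V_set w -> V_set (alpha * w).
Proof.
apply: (@zspan_morph _ _ (GRing.mull_fun alpha idfun)) => _ [j _ <-] /=.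
have -> : alpha * v 0 j = \sum_i Qadj_rat a (M i j) * v 0 i.
  have /matrixP /(_ 0 j) := hv.2; rewrite !mxE => <-.
  by apply: eq_bigr => i _; rewrite mxE mulrC.
apply: zspan_sum => i; rewrite mxE rmorph_nat mulr_natl pmulrn.
by apply/zspanMz/zspan_gen; exists i.
Qed.

Lemma V_set_alphaX k w : V_set w -> V_set (alpha ^+ k * w).
Proof.
move=> hw; elim: k => [|k IH]; first by rewrite mul1r.
by rewrite exprS -mulrA; exact: V_set_alpha.
Qed.

Lemma VZ_setM w k : V_set w -> VZ_set (w * alpha^-1 ^+ k).
Proof.
move=> hw; apply: zspan_gen; exists w => //; exists (alpha^-1 ^+ k) => //.
by exists 'X^k => //; rewrite map_polyXn hornerXn.
Qed.

Lemma VZ_set_alpha w : VZ_set w -> VZ_set (alpha * w).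
Proof.
apply: (@zspan_morph _ _ (GRing.mull_fun alpha idfun)) => _ [x hx [y hy <-]] /=.
by apply: zspan_gen; exists (alpha * x); [exact: V_set_alpha|exists y; rewrite ?mulrA].
Qed.

Lemma pairing_Z x : Z_set x -> VZ_set (pairing x).
Proof.
move=> [k _ [z /pairing_Zn hz <-]].
have [uM|nuM] := boolP (M \in unitmx); last first.
  rewrite /invmx (negPf nuM).
  suff -> : pairing (M ^+ k *m z) = alpha ^+ k * pairing z.
    by rewrite -[_ * _]mulr1 -(expr0 alpha^-1); apply/VZ_setM/V_set_alphaX.
  elim: k => [|k IH]; first by rewrite mul1mx mul1r.
  by rewrite exprS -mulmxA pairing_mulmx IH mulrA -exprS.
have a0 : alpha != 0.
  apply: contraTneq (hv.1) => a0; rewrite negbK.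
  have := hv.2; rewrite a0 scale0r => h.
  have uM' : map_mx (@Qadj_rat a) M \in unitmx by rewrite map_unitmx.
  by rewrite -[v](mulmxK uM') h mul0mx.
suff -> : pairing (invmx M ^+ k *m z) = pairing z * alpha^-1 ^+ k.
  exact: VZ_setM.
elim: k => [|k IH]; first by rewrite mul1mx mulr1.
apply: (mulfI a0); rewrite exprS -pairing_mulmx -mulmxA (mulKVmx uM).
by rewrite IH exprS mulrCA (mulrA alpha) mulfV // mul1r.
Qed.
End Lattices.

Section Coordinates.
Context (m : nat) (sigma : substitution m.+1) (a : algC) (v : 'rV[Qadj a]_m.+1).
Local Notation K := (Qadj a).
Local Notation alpha := (Qadj_gen a).
Local Notation M := (incidence_mx sigma).
Hypothesis irrM : irreducible_poly (char_poly M).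
Hypothesis hv : left_eigenvector sigma v.

Lemma pairingD x y : pairing v (x + y) = pairing v x + pairing v y.
Proof. by rewrite !pairingE map_mxD mulmxDr mxE. Qed.
Lemma pairingZ c x : pairing v (c *: x) = Qadj_rat a c * pairing v x.
Proof. by rewrite !pairingE map_mxZ -scalemxAr mxE. Qed.

Lemma pairing_horner (p : {poly rat}) z :
  pairing v (horner_mx M p *m z) = (map_poly (Qadj_rat a) p).[alpha] * pairing v z.
Proof.
elim/poly_ind: p z => [|p c IH] z.
  rewrite !rmorph0 horner0 mul0mx mul0r -[0 in LHS](scale0r 0) pairingZ rmorph0.
  by rewrite mul0r.
rewrite !rmorphD !rmorphM /= horner_mx_X horner_mx_C map_polyX map_polyC.
rewrite !hornerE mulmxDl mul_scalar_mx pairingD pairingZ.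
by rewrite -mulmxA IH (pairing_mulmx hv) mulrDl mulrA.
Qed.

Lemma pairing_inj0 c : pairing v c = 0 -> c = 0.
Proof.
move=> c0; have hp p : pairing v (horner_mx M p *m c) = 0.
  by rewrite pairing_horner c0 mulr0.
pose A : 'M[rat]_m.+1 := \matrix_(i, j) (M ^+ i *m c) j 0.
have Av : v *m map_mx (Qadj_rat a) A^T = 0.
  apply/rowP => i; have := hp 'X^i; rewrite rmorphXn /= horner_mx_X pairingE.
  by rewrite !mxE => h; rewrite -[RHS]h; apply: eq_bigr => j _; rewrite !mxE.
have [d0|d0] := boolP (\det A == 0); last first.
  have uA : map_mx (Qadj_rat a) A^T \in unitmx.
    by rewrite map_unitmx unitmx_tr unitmxE unitfE.
  have := hv.1; rewrite -[v](mulmxK uA) Av mul0mx eqxx //.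
have [u u0 uA] := det0P d0.
pose p := rVpoly u.
have p0 : p != 0.
  by apply: contra u0 => /eqP p0; rewrite -(rVpolyK u) -/p p0 linear0.
have pc : horner_mx M p *m c = 0.
  apply/colP => j; have E : \sum_i u 0 i * A i j = 0.
    by move/rowP/(_ j): uA; rewrite [LHS]mxE [RHS]mxE.
  rewrite [RHS]mxE -E.
  rewrite /p /rVpoly poly_def (raddf_sum (horner_mx M)) /=. rewrite mulmx_suml summxE.
  apply: eq_bigr => i _; rewrite linearZ rmorphXn /= horner_mx_X -scalemxAl !mxE.
  by congr (_ * _); rewrite insubT //= => ?; congr (u _ _); exact: val_inj.
have cop : coprimep (char_poly M) p.
  rewrite irreducible_poly_coprime //; apply/negP => /(dvdp_leq p0).
  by rewrite size_char_poly leqNgt ltnS size_poly.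
have /Bezout_coprimepP [[w1 w2] /= /eqpP [[k1 k2] /= /andP [k10 k20]]] := cop.
move=> E; have := congr1 (fun q => horner_mx M q *m c) E.
rewrite -!mul_polyC mulr1 mulrDr !mulrA rmorphD /= !rmorphM /= Cayley_Hamilton.
rewrite mulr0 add0r -mulmxA pc mulmx0 horner_mx_C mul_scalar_mx => /esym /eqP.
by rewrite scaler_eq0 (negPf k20) => /eqP.
Qed.

Lemma pairing_inj : injective (pairing v).
Proof.
move=> x y xy; apply/eqP; rewrite -subr_eq0; apply/eqP/pairing_inj0.
by rewrite -scaleN1r pairingD pairingZ rmorphN1 mulN1r xy subrr.
Qed.

Lemma pairing_surj (w : K) : exists x, pairing v x = w.
Proof.
have hor (p : {poly rat}) :
    val (map_poly (Qadj_rat a) p).[alpha] = (map_poly ratr p).[a].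
  by rewrite -horner_map -map_poly_comp; congr (_.[_]).
have stab x y : exists z, pairing v z = x * pairing v y.
  have [p [q xpq]] := asboolW (Qadj_valP x).
  have [q0|q0] := eqVneq (map_poly (Qadj_rat a) q).[alpha] 0.
    exists 0; rewrite -[0 in LHS](scale0r 0) pairingZ rmorph0 mul0r.
    have -> : x = 0; last by rewrite mul0r.
    by apply: val_inj; rewrite /= xpq -(hor q) q0 /= invr0 mulr0.
  have uq : horner_mx M q \in unitmx.
    rewrite unitmxE unitfE -det_tr; apply/det0P => -[u u0 uq]; case/eqP: u0.
    apply: trmx_inj; rewrite trmx0; apply: pairing_inj0; apply: (mulfI q0).
    rewrite -pairing_horner mulr0 -[_ *m _]trmxK trmx_mul trmxK uq trmx0.
    by rewrite -[0 in LHS](scale0r 0) pairingZ rmorph0 mul0r.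
  exists (invmx (horner_mx M q) *m (horner_mx M p *m y)).
  apply: (mulfI q0); rewrite -pairing_horner mulKVmx // pairing_horner mulrA.
  congr (_ * _); have -> : x = (map_poly (Qadj_rat a) p).[alpha]
      / (map_poly (Qadj_rat a) q).[alpha]; last by rewrite mulrC divfK.
  by apply: val_inj; rewrite [RHS](fmorph_div val) [LHS]xpq -!hor.
have [i vi] : exists i, v 0 i != 0.
  apply/existsP; rewrite -negb_forall; apply: contra hv.1 => /forallP h.
  by apply/eqP/rowP => i; rewrite mxE; apply/eqP.
have [z hz] := stab (w / v 0 i) (delta_mx i 0); exists z.
rewrite hz /pairing (bigD1 i) //= big1 => [|j ji].
  by rewrite mxE !eqxx rmorph1 mul1r addr0 divfK.
by rewrite mxE (negPf ji) rmorph0 mul0r.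
Qed.

End Coordinates.

(** coords v (z_1 v_1 + ... + z_n v_n) = (z_1, ..., z_n)^t is the map usually called
    f; by coordsK and pairingK its inverse is x |-> <x, v>, whose restriction to Z
    is f_inv below. *)
Definition coords (n : nat) (a : algC) (v : 'rV[Qadj a]_n) (w : Qadj a) : 'cV[rat]_n :=
  xget 0 [set z : 'cV[rat]_n | \sum_i Qadj_rat a (z i 0) * v 0 i = w].

Lemma pairing_bij (n : nat) (sigma : substitution n) (a : algC)
    (v : 'rV[Qadj a]_n) :
  irreducible_poly (char_poly (incidence_mx sigma)) -> left_eigenvector sigma v ->
  injective (pairing v) /\ forall w, exists x, pairing v x = w.
Proof.
case: n sigma v => [|m] sigma v irr hv.
  by have /eqP := hv.1; case; apply/rowP; case.
by split; [exact: pairing_inj irr hv | exact: pairing_surj irr hv].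
Qed.

Lemma coordsK (n : nat) (sigma : substitution n) (a : algC) (v : 'rV[Qadj a]_n) :
  irreducible_poly (char_poly (incidence_mx sigma)) -> left_eigenvector sigma v ->
  cancel (coords v) (pairing v).
Proof.
move=> irr hv w; have [x hx] := (pairing_bij irr hv).2 w.
by rewrite /coords; case: xgetP => [z _ //|/(_ x)].
Qed.

Lemma pairingK (n : nat) (sigma : substitution n) (a : algC) (v : 'rV[Qadj a]_n) :
  irreducible_poly (char_poly (incidence_mx sigma)) -> left_eigenvector sigma v ->
  cancel (pairing v) (coords v).
Proof.
move=> irr hv x; apply: (pairing_bij irr hv).1; exact: coordsK irr hv _.
Qed.

Section Cube.
Context (R : realType) (n : nat) (sigma : substitution n) (a : algC).
Context (v : 'rV[Qadj a]_n).
Local Notation K := (Qadj a).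
Local Notation alpha := (Qadj_gen a).
Local Notation M := (incidence_mx sigma).

Definition Z_ext : Type := (Z_set sigma * K_fin R a)%type.

Definition M_Z (x : Z_set sigma) : Z_set sigma :=
  exist _ (M *m val x) (mem_set (Z_set_mulmx (set_mem (valP x)))).

Definition M_Zext (z : Z_ext) : Z_ext := (M_Z z.1, alpha *: z.2).

Definition Psi (x : Z_set sigma) : Z_ext := (x, diag _ (pairing v (val x))).

Definition Phi (w : VZ_set v) : K_alpha R a := diag _ (val w).

Definition F (z : Z_ext) : K_alpha R a :=
  join_completions (\sum_i Qadj_rat a (val z.1 i 0) *: diag (@infinite_places R a) (v 0 i)) z.2.

Definition mul_K_alpha (y : K_alpha R a) : K_alpha R a := alpha *: y.

Definition mul_VZ (hv : left_eigenvector sigma v) (w : VZ_set v) : VZ_set v :=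
  exist _ (alpha * val w) (mem_set (VZ_set_alpha hv (set_mem (valP w)))).

Definition f_inv (hv : left_eigenvector sigma v) (x : Z_set sigma) : VZ_set v :=
  exist _ (pairing v (val x)) (mem_set (pairing_Z hv (set_mem (valP x)))).

End Cube.

Arguments M_Z {n} sigma x.
Arguments M_Zext {R n} sigma {a} z.
Arguments Psi R {n} sigma {a} v x.
Arguments Phi R {n a} v w.
Arguments F {R n} sigma {a} v z.
Arguments mul_K_alpha {R} a y.

(* Main.v *)
From HB Require Import structures.
Require Import Defs.
From mathcomp Require Import all_boot all_order all_algebra all_field.
From mathcomp Require Import all_classical all_reals.

Import GRing.Theory.

Local Open Scope ring_scope.

(** Two facts carry all five squares: the eigenvector relation $\langle M_\sigma\mathbf x,\mathbf
    v_\alpha\rangle=\alpha\langle\mathbf x,\mathbf v_\alpha\rangle$ ([pairing_mulmx]) and the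
    $K$-linearity of the diagonal embeddings. By linearity the infinite block of $F$ is
    $\Phi_\infty(\langle\mathbf x,\mathbf v_\alpha\rangle)$ ([F_pairing]), so $F$ intertwines the
    actions of $M_\sigma$ and $\alpha$, and on the image of $\Psi$ it glues two diagonals of the
    same element ([join_completions_diag]). *)

Section Diagonal.
Context (R : realType) (a : algC).
Implicit Types (S : set (place R (Qadj a))) (c d : Qadj a).

Lemma diagM S c d : diag S (c * d) = c *: diag S d.
Proof. by apply: functional_extensionality_dep => p; rewrite /diag rmorphM. Qed.

Lemma diag_zmod_morphism S : zmod_morphism (@diag R a S).
Proof.
by move=> c d; apply: functional_extensionality_dep => p; rewrite /diag rmorphB.
Qed.

HB.instance Definition _ S :=
  GRing.isZmodMorphism.Build (Qadj a) (prod_completions S) (diag S)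
    (diag_zmod_morphism S).

Lemma diag_pairing S n (v : 'rV[Qadj a]_n) (x : 'cV[rat]_n) :
  diag S (pairing v x) = \sum_i Qadj_rat a (x i 0) *: diag S (v 0 i).
Proof. by rewrite raddf_sum; apply: eq_bigr => i _; rewrite /= diagM. Qed.

Lemma join_completionsZ c (x : K_infty R a) (y : K_fin R a) :
  join_completions (c *: x) (c *: y) = c *: join_completions x y :> K_alpha R a.
Proof.
apply: functional_extensionality_dep => p.
by rewrite /GRing.scale /= /scaleK /join_completions; case: pselect.
Qed.

(** Both branches of the gluing give the image of [c] in the same completion, since [diag] sees the
    place and not the proof of membership. *)
Lemma join_completions_diag c :
  join_completions (diag (@infinite_places R a) c) (diag _ c) = diag _ c.
Proof.
apply: functional_extensionality_dep => p.
by rewrite /join_completions; case: pselect.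
Qed.

(** Puts $F$ in a form to which the eigenvector relation applies. *)
Lemma F_pairing n (sigma : substitution n) (v : 'rV[Qadj a]_n)
    (z : Z_ext R sigma a) :
  F sigma v z = join_completions (diag _ (pairing v (val z.1))) z.2.
Proof. by rewrite diag_pairing. Qed.

End Diagonal.

Theorem theorem7p3 (R : realType) (n : nat) (sigma : substitution n)
    (alpha : algC) (v : 'rV[Qadj alpha]_n)
    (Hsigma : irreducible_Pisot sigma)
    (Halpha : dominant_eigenvalue (incidence_mx sigma) alpha)
    (Hv : left_eigenvector sigma v) :
  [/\ Psi R sigma v \o M_Z sigma =1 M_Zext sigma \o Psi R sigma v,
      f_inv Hv \o M_Z sigma =1 mul_VZ Hv \o f_inv Hv,
      F sigma v \o M_Zext sigma =1 @mul_K_alpha R alpha \o F sigma v,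
      Phi R v \o mul_VZ Hv =1 mul_K_alpha alpha \o Phi R v
    & F sigma v \o Psi R sigma v =1 Phi R v \o f_inv Hv ].
Proof.
split=> [x|x|z|w|x] /=.
(* The $Z$-components agree by definition; only the finite places need the eigenvector relation. *)
- by rewrite /Psi /M_Zext /= (pairing_mulmx Hv) diagM.
- by apply: val_inj; rewrite /= (pairing_mulmx Hv).
- by rewrite /mul_K_alpha !F_pairing /= (pairing_mulmx Hv) diagM join_completionsZ.
- by rewrite /Phi /= diagM.
- by rewrite F_pairing join_completions_diag.
Qed.
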